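(* Let $M\ge 1$ be a fixed integer, $\beta>0$, $\lambda,h\in\mathbb{R}$, and assume either $\beta\le 1$, or $\beta>1$ and $\lambda\neq 0$, $h\neq 0$. Then for every $\boldsymbol{\epsilon}\in\{-1,1\}^M$ the limit $$-\beta f(\beta,M;\lambda,h\boldsymbol{\epsilon}) := \lim_{N\to\infty}\frac1N\,\mathbb{E}_{\mathcal{S}\sim P^{CW}_{\beta,h\boldsymbol{\epsilon}}}\big[\log Z(\mathcal{S};\beta,\lambda,M)\big]$$ exists, does not depend on $\boldsymbol{\epsilon}$, and equals $$\sup_{\mathbf{p}\in\mathbb{R}^M} g(\mathbf{p};\beta,\lambda,h),\qquad g(\mathbf{p};\beta,\lambda,h)=\log 2-\frac{\beta|\mathbf{p}|^2}{2}+\big\langle \log\cosh(\beta\,\mathbf{s}\cdot\mathbf{p}+\lambda)\big\rangle_{\mathbf{s}},$$ where $\langle\cdot\rangle_{\mathbf{s}}$ is the expectation over a random vector $\mathbf{s}\in\{-1,1\}^M$ with i.i.d. entries of mean $m_0(\beta,h)$.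
   Context: For $N\ge 2$, a training set is $\mathcal{S}=(\mathbf{s}^1,\dots,\mathbf{s}^M)$ with $\mathbf{s}^\mu=(s^\mu_1,\dots,s^\mu_N)\in\{-1,1\}^N$. For $\mathbf{h}=(h^1,\dots,h^M)\in\mathbb{R}^M$, the Curie–Weiss product measure is $$P^{CW}_{\beta,\mathbf{h}}(\mathcal{S})=\prod_{\mu=1}^M z_{\beta,h^\mu}^{-1}\exp\Big(\frac{\beta}{N}\sum_{i<j}s^\mu_is^\mu_j+h^\mu\sum_{i=1}^N s^\mu_i\Big),$$ with $z_{\beta,h^\mu}$ the normalizing constants. The partition function is $$Z(\mathcal{S};\beta,\lambda,M)=\sum_{\boldsymbol{\xi}\in\{-1,1\}^N}\exp\Big(\frac{\beta}{N}\sum_{\mu=1}^M\sum_{i<j}s^\mu_is^\mu_j\xi_i\xi_j+\lambda\sum_{i=1}^N\xi_i\Big).$$ For $\beta>0$, $h\in\mathbb{R}$, $m_0(\beta,h):=\operatorname{argmax}_{x\in\mathbb{R}}\big[\log 2+\log\cosh(\beta x+h)-\beta x^2/2\big]$ (unique when $h\neq0$ or $\beta\le1$); it solves $m_0=\tanh(\beta m_0+h)$. *)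

(* Defs.v *)
From HB Require Import structures.
From mathcomp Require Import all_boot all_order all_algebra.
From mathcomp Require Import all_classical all_reals all_analysis.
Set Implicit Arguments. Unset Strict Implicit. Unset Printing Implicit Defensive.
Import Order.TTheory GRing.Theory Num.Theory.
Local Open Scope ring_scope.
Local Open Scope classical_set_scope.

Section CW.
Variable R : realType.

Definition spin (b : bool) : R := if b then 1 else -1.

Definition config (N : nat) := {ffun 'I_N -> bool}.
Definition tset (N M : nat) := {ffun 'I_M -> config N}.

Definition cosh (x : R) : R := (expR x + expR (- x)) / 2.

Definition cw_exponent (N : nat) (beta h : R) (s : config N) : R :=
  beta / N%:R * (\sum_(i < N) \sum_(j < N | (i < j)%N) spin (s i) * spin (s j))
  + h * \sum_(i < N) spin (s i).

Definition cw_z (N : nat) (beta h : R) : R :=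
  \sum_(s : config N) expR (cw_exponent beta h s).

Definition P_CW (N M : nat) (beta : R) (hv : 'I_M -> R) (S : tset N M) : R :=
  \prod_(mu < M) (expR (cw_exponent beta (hv mu) (S mu)) / cw_z N beta (hv mu)).

Definition Zpart (N M : nat) (beta lambda : R) (S : tset N M) : R :=
  \sum_(xi : config N)
    expR (beta / N%:R *
            (\sum_(mu < M) \sum_(i < N) \sum_(j < N | (i < j)%N)
               spin (S mu i) * spin (S mu j) * spin (xi i) * spin (xi j))
          + lambda * \sum_(i < N) spin (xi i)).

Definition avg_free_energy (N M : nat) (beta lambda : R) (hv : 'I_M -> R) : R :=
  N%:R^-1 * \sum_(S : tset N M) P_CW beta hv S * ln (Zpart beta lambda S).

Definition phi0 (beta h x : R) : R :=
  ln 2 + ln (cosh (beta * x + h)) - beta * x ^+ 2 / 2.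

(* m_0(beta,h) := argmax_x phi0 beta h x (chosen by xget; unique when
   h <> 0 or beta <= 1) *)
Definition m0 (beta h : R) : R :=
  xget 0 [set m | forall x, phi0 beta h x <= phi0 beta h m].

(* < F(s) >_s : expectation over s in {-1,1}^M with i.i.d. entries of mean m *)
Definition savg (M : nat) (m : R) (F : {ffun 'I_M -> bool} -> R) : R :=
  \sum_(s : {ffun 'I_M -> bool}) (\prod_(mu < M) ((1 + m * spin (s mu)) / 2)) * F s.

Definition gfun (M : nat) (beta lambda h : R) (p : 'I_M -> R) : R :=
  ln 2 - beta * (\sum_(mu < M) p mu ^+ 2) / 2
  + savg (m0 beta h)
      (fun s => ln (cosh (beta * (\sum_(mu < M) spin (s mu) * p mu) + lambda))).

End CW.

(* Main.v *)
(* With [q] the overlap vector of [xi] with the patterns, the exponent in [Z] is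
   a square in [q]: [q^2 >= 2 p q - p^2] for every [p], with equality at
   [p = q].  Linearizing the squares bounds [Z] from below by [exp (N G_S(p))]
   for every [p], and, since [q] takes at most [(N+1)^M] values, from above by
   [(N+1)^M exp (N max_p G_S(p))] up to constants.  [G_S(p)] depends on [S] only
   through the empirical law of the columns [(s^mu_i)_mu], and it is enough that
   this law converges in mean to the product law of mean [m0].  Its first two
   moments factor over [mu], and by exchangeability they involve only the first
   two moments of the Curie-Weiss magnetization.  The latter concentrates at
   [m0] by the same two bounds on [Z] with [M = 1], because [m0] is the unique
   maximizer of [phi0].  The signs [eps] are gauged away by flipping patterns. *)
Require Import Defs.
From HB Require Import structures.
From mathcomp Require Import all_boot all_order all_algebra.
From mathcomp Require Import all_classical all_reals all_analysis.
From mathcomp Require Import fingroup perm ring lra.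
Set Implicit Arguments. Unset Strict Implicit. Unset Printing Implicit Defensive.
Import Order.TTheory GRing.Theory Num.Theory numFieldNormedType.Exports.
Local Open Scope ring_scope.
Local Open Scope classical_set_scope.

(** * Hyperbolic functions: addition formulas, monotonicity and bounds on [ln (cosh x)] *)

Section Hyperbolic.
Context {R : realType}.
Implicit Types x y a b : R.

Definition sinh x : R := (expR x - expR (- x)) / 2.

Lemma sinhN x : sinh (- x) = - sinh x.
Proof. by rewrite /sinh opprK; field. Qed.

Lemma coshN x : cosh (- x) = cosh x.
Proof. by rewrite /cosh opprK addrC. Qed.

Lemma cosh_abs x : cosh `|x| = cosh x.
Proof. by case: (ler0P x) => // _; rewrite coshN. Qed.

Lemma sinhB a b : sinh (a - b) = sinh a * cosh b - cosh a * sinh b.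
Proof.
rewrite /sinh /cosh opprB !expRD !expRN.
by have := expR_gt0 a; have := expR_gt0 b => *; field; lra.
Qed.

Lemma sinhD a b : sinh (a + b) = sinh a * cosh b + cosh a * sinh b.
Proof. by rewrite -{1}(opprK b) sinhB coshN sinhN mulrN opprK. Qed.

Lemma coshD a b : cosh (a + b) = cosh a * cosh b + sinh a * sinh b.
Proof.
rewrite /sinh /cosh opprD !expRD !expRN.
by have := expR_gt0 a; have := expR_gt0 b => *; field; lra.
Qed.

Lemma cosh2_sinh2 x : cosh x ^+ 2 = 1 + sinh x ^+ 2.
Proof.
rewrite /sinh /cosh !expRN.
by have := expR_gt0 x => *; field; lra.
Qed.

Lemma cosh_gt0 x : 0 < cosh x.
Proof. by rewrite /cosh; have := expR_gt0 x; have := expR_gt0 (- x); lra. Qed.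

Lemma cosh_ge1 x : 1 <= cosh x.
Proof. by have := cosh2_sinh2 x; have := cosh_gt0 x; nra. Qed.

Lemma norm_sinh_le_cosh x : `|sinh x| <= cosh x.
Proof.
rewrite /sinh /cosh ler_norml.
by have := expR_gt0 x; have := expR_gt0 (- x) => ? ?; apply/andP; split; lra.
Qed.

Lemma sinh_gt0 x : 0 < x -> 0 < sinh x.
Proof.
move=> x0; have : expR (- x) < expR x by rewrite ltr_expR; lra.
by rewrite /sinh; lra.
Qed.

Lemma cosh_lt x y : 0 <= x -> x < y -> cosh x < cosh y.
Proof.
(* With half-sum [u] and half-difference [t], the difference [cosh y - cosh x] equals
   [2 * sinh u * sinh t]. *)
move=> x0 xy; set t := (y - x) / 2; set u := (x + y) / 2.
have -> : y = u + t by rewrite /t /u; field.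
have -> : x = u - t by rewrite /t /u; field.
rewrite !coshD coshN sinhN.
have := @sinh_gt0 t ltac:(rewrite /t; lra).
by have := @sinh_gt0 u ltac:(rewrite /u; lra); nra.
Qed.

Lemma cosh_lt_norm x y : `|x| < y -> cosh x < cosh y.
Proof. by move=> xy; rewrite -(cosh_abs x); apply: cosh_lt. Qed.

Lemma cosh_le_norm x : cosh x <= expR `|x|.
Proof.
rewrite -cosh_abs /cosh.
have : expR (- `|x|) <= expR `|x| by rewrite ler_expR; have := normr_ge0 x; lra.
lra.
Qed.

Lemma is_derive_sinh x : is_derive x 1 sinh (cosh x).
Proof.
have -> : sinh = fun x : R => 2^-1 *: (expR x - expR (- x)).
  by apply/funext => y; rewrite /sinh mulrC.
by apply: is_derive_eq; rewrite /cosh /GRing.scale/=; field.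
Qed.

Lemma is_derive_cosh x : is_derive x 1 (@cosh R) (sinh x).
Proof.
have -> : @cosh R = fun x : R => 2^-1 *: (expR x + expR (- x)).
  by apply/funext => y; rewrite /cosh mulrC.
by apply: is_derive_eq; rewrite /sinh /GRing.scale/=; field.
Qed.

Lemma sinh_MVT a b : a < b ->
  exists2 c, a < c < b & sinh b - sinh a = cosh c * (b - a).
Proof.
move=> ab.
have [|c cab ->] := @MVT R sinh (@cosh R) a b ab (fun x _ => is_derive_sinh x).
  apply: derivable_within_continuous => x _.
  by have [] := is_derive_sinh x.
by exists c => //; move: cab; rewrite in_itv.
Qed.

(** The mean value theorem from 0 gives [sinh x = x * cosh c] with [0 < c < x]. This is
    [tanh x < x], the strict inequality behind uniqueness for [be <= 1]. *)
Lemma sinh_lt_mul_cosh x : 0 < x -> sinh x < x * cosh x.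
Proof.
move=> x0; have [c /andP[c0 cx]] := sinh_MVT x0.
have -> : sinh 0 = 0 by rewrite /sinh oppr0 subrr mul0r.
have := cosh_lt (ltW c0) cx.
rewrite !subr0 => cc ->; nra.
Qed.

(* Convexity of [sinh] on the half-line, in the form that [sinh t / t]
   increases. *)
Lemma sinh_chord a b : 0 < a -> a < b -> b * sinh a <= a * sinh b.
Proof.
move=> a0 ab; have [c /andP[c0 ca]] := sinh_MVT a0.
have -> : sinh 0 = 0 by rewrite /sinh oppr0 subrr mul0r.
have [d /andP[d0 db]] := sinh_MVT ab.
have cd : cosh c < cosh d by apply: cosh_lt; lra.
rewrite !subr0 => e1 e2.
have -> : sinh b = sinh a + cosh c * (b - a) + (cosh d - cosh c) * (b - a).
  by rewrite mulrBl -e1; lra.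
rewrite e2; have : 0 <= (cosh d - cosh c) * (b - a) by nra.
nra.
Qed.

(* [tanh t / t] decreases on the positive half-line. *)
Lemma tanh_chord a b : 0 < a -> a < b ->
  a * (sinh b * cosh a) <= b * (sinh a * cosh b).
Proof.
move=> a0 ab.
(* Once the addition formulas are expanded, the chord inequality between [b - a] and [a + b] is
   twice the claim. *)
have := @sinh_chord (b - a) (a + b) ltac:(lra) ltac:(lra).
by rewrite sinhB sinhD (mulrC (cosh b)) (mulrC (cosh a)); lra.
Qed.

Lemma ln_cosh_ge0 x : 0 <= ln (cosh x).
Proof. exact: ln_ge0 (cosh_ge1 x). Qed.

Lemma ln_cosh_le_norm x : ln (cosh x) <= `|x|.
Proof.
rewrite -[leRHS]expRK ler_ln ?posrE ?cosh_gt0 ?expR_gt0 //.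
exact: cosh_le_norm.
Qed.

(** Since [exp |a| = cosh a + |sinh a|] and [|sinh b| <= cosh b], expanding [cosh (a + b)] bounds it
    by [exp |a| * cosh b]. *)
Lemma ln_coshD_le a b : ln (cosh (a + b)) <= `|a| + ln (cosh b).
Proof.
rewrite -[`|a|]expRK -lnM ?posrE ?expR_gt0 ?cosh_gt0 //.
rewrite ler_ln ?posrE ?cosh_gt0 ?(mulr_gt0 (expR_gt0 _) (cosh_gt0 _)) //.
have := norm_sinh_le_cosh b; rewrite coshD => sb.
have -> : expR `|a| = cosh a + `|sinh a|.
  case: (ler0P a) => [a0|a0].
    rewrite ler0_norm; first by rewrite /cosh /sinh; field.
    rewrite -oppr_ge0 -sinhN; case: (ltgtP a 0) a0 => // [a1|->] _.
      by apply/ltW/sinh_gt0; lra.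
    by rewrite /sinh !oppr0 subrr mul0r.
  rewrite gtr0_norm ?sinh_gt0//; by rewrite /cosh /sinh; field.
rewrite mulrDl lerD2l (le_trans (ler_norm _)) // normrM.
exact: ler_wpM2l.
Qed.

Lemma is_derive_ln_cosh (be h x : R) :
  is_derive x 1 (fun x => ln (cosh (be * x + h)))
    (be * sinh (be * x + h) / cosh (be * x + h)).
Proof.
have d1 : is_derive x 1 (fun x : R => be * x + h) be.
  apply: (@is_derive_eq _ _ _ (fun x : R => be *: x + cst h x)).
  by rewrite /GRing.scale/= addr0 mulr1.
have d2 := @is_derive1_comp R (@cosh R) (fun x => be * x + h) x _ _
  (is_derive_cosh _) d1.
have d3 := @is_derive1_comp R (@ln R) (@cosh R \o (fun x => be * x + h)) x _ _ (is_derive1_ln (cosh_gt0 _)) d2.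
by apply: is_derive_eq; rewrite /GRing.scale/=; field; rewrite gt_eqF // cosh_gt0.
Qed.

End Hyperbolic.

(** * The maximizer of [phi0]: existence, uniqueness and a strict gap away from it *)

Section MeanFieldMagnetization.
Context {R : realType}.
Implicit Types be h x y : R.

Definition is_argmax be h m := forall x, phi0 be h x <= phi0 be h m.

Lemma is_derive_phi0 be h x :
  is_derive x 1 (phi0 be h)
    (be * (sinh (be * x + h) / cosh (be * x + h) - x)).
Proof.
have -> : phi0 be h = fun x => (ln 2 + ln (cosh (be * x + h))) - (be / 2) *: x ^+ 2.
  by apply/funext => y; rewrite /phi0 /GRing.scale/=; field.
have d := is_derive_ln_cosh be h x.
apply: is_derive_eq; rewrite /GRing.scale/=. field.
by rewrite gt_eqF // cosh_gt0.
Qed.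

Lemma continuous_phi0 be h a b : {within `[a, b], continuous (phi0 be h)}.
Proof.
by apply: derivable_within_continuous => x _; have [] := is_derive_phi0 be h x.
Qed.

(** Outside [[-2, 2]] the quadratic term wins: [ln (cosh (be * x + h))] exceeds its value at 0 by at
    most [be * |x|], while [be * x ^ 2 / 2 >= be * |x|]. Hence a maximum over this interval is
    global. *)
Lemma argmax_exists be h : 0 < be -> exists m, is_argmax be h m.
Proof.
move=> be0; have [|c c2 cmax] := EVT_max _ (@continuous_phi0 be h (-2) 2).
  by lra.
exists c => x; case: (boolP (x \in `[(-2 : R), 2]%R)) => [xI|]; first exact: cmax.
rewrite in_itv/= -ler_norml -ltNge => x2.
have : phi0 be h 0 <= phi0 be h c by apply: cmax; rewrite in_itv/=; apply/andP; split; lra.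
apply: le_trans; rewrite /phi0 mulr0 add0r expr0n mulr0 mul0r subr0.
have := ln_coshD_le (be * x) h; rewrite normrM (gtr0_norm be0).
have -> : x ^+ 2 = `|x| ^+ 2 by rewrite real_normK ?num_real.
have : 0 <= (`|x| - 2) * `|x| * be by rewrite !mulr_ge0 //; lra.
by lra.
Qed.

(** Stationarity at an interior maximum; this is [m = tanh (be * m + h)] cleared of its
    denominator. *)
Lemma argmax_eq be h m : 0 < be -> is_argmax be h m ->
  sinh (be * m + h) = m * cosh (be * m + h).
Proof.
move=> be0 mmax.
have mI : m \in `](m - 1), (m + 1)[%R by rewrite in_itv/=; apply/andP; split; lra.
have d0 : is_derive m 1 (phi0 be h) 0.
  apply: (derive1_at_max _ _ mI); first by lra.
    by move=> t _; have [] := is_derive_phi0 be h t.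
  by move=> t _; exact: mmax.
have [_ e0] := d0; have [_ e1] := is_derive_phi0 be h m.
have := cosh_gt0 (be * m + h) => c0.
have : be * (sinh (be * m + h) / cosh (be * m + h) - m) = 0 by rewrite -e1 e0.
move=> /eqP; rewrite mulf_eq0 (gt_eqF be0)/= subr_eq0 => /eqP {2}<-.
by rewrite divfK // gt_eqF.
Qed.

Lemma argmax_norm_le1 be h m : 0 < be -> is_argmax be h m -> `|m| <= 1.
Proof.
move=> be0 /(argmax_eq be0) e; have := norm_sinh_le_cosh (be * m + h).
have c0 := cosh_gt0 (be * m + h).
by rewrite e normrM (gtr0_norm c0) ger_pMl.
Qed.

(** With [a], [b] the fields at [x], [y] and [2 t = b - a], the two stationarity equations give
    [sinh (2 t) = (y - x) * cosh a * cosh b]. Here [y - x >= 2 t] because [be <= 1], and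
    [cosh a * cosh b >= cosh t ^ 2]. So [sinh t >= t * cosh t], against [tanh t < t]. *)
Lemma argmax_uniq_le1 be h x y : 0 < be -> be <= 1 ->
  is_argmax be h x -> is_argmax be h y -> x < y -> False.
Proof.
move=> be0 be1 /(argmax_eq be0) ex /(argmax_eq be0) ey xy.
set a := be * x + h in ex; set b := be * y + h in ey; set t := (b - a) / 2.
have t0 : 0 < t by rewrite /t /a /b; nra.
have cab : cosh a * cosh b = (cosh (a + b) + cosh (b - a)) / 2.
  by rewrite (coshD a b) (coshD b (- a)) coshN sinhN; field.
have sba : sinh (b - a) = (y - x) * (cosh a * cosh b) by rewrite (sinhB b a) ey ex; ring.
have ba : b - a = t + t by rewrite /t; field.
have yx : b - a <= y - x by rewrite /a /b; nra.
have := sinh_lt_mul_cosh t0.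
have ct0 := cosh_gt0 t.
have cs := cosh2_sinh2 t.
have c1 := cosh_ge1 (a + b).
have ccc : cosh t ^+ 2 <= cosh a * cosh b.
  by rewrite cab ba [cosh (t + t)]coshD -!expr2; lra.
have : (b - a) * cosh t ^+ 2 <= (y - x) * (cosh a * cosh b).
  apply: ler_pM => //; [lra|exact: sqr_ge0].
rewrite -sba ba sinhD => H1 H2.
nra.
Qed.

(** For [m < 0 < h] the reflected point [- m] does strictly better, as its field is larger in
    absolute value. *)
Lemma argmax_pos_ge0 be h m : 0 < be -> 0 < h -> is_argmax be h m -> 0 <= m.
Proof.
move=> be0 h0 mmax; rewrite leNgt; apply/negP => m0.
have := mmax (- m); rewrite /phi0 sqrrN mulrN leNgt => /negP; apply.
have : cosh (be * m + h) < cosh (- (be * m) + h).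
  by apply: cosh_lt_norm; rewrite ltr_norml; apply/andP; split; nra.
by rewrite -ltr_ln ?posrE ?cosh_gt0 //; lra.
Qed.

(** Both fields are positive, so monotonicity of [tanh t / t] applies; with the stationarity
    equations it reads [(be * x + h) * y <= (be * y + h) * x], that is [h * (y - x) <= 0]. *)
Lemma argmax_uniq_pos be h x y : 0 < be -> 0 < h ->
  is_argmax be h x -> is_argmax be h y -> x < y -> False.
Proof.
move=> be0 h0 mx my xy.
have x0 := argmax_pos_ge0 be0 h0 mx.
have := @tanh_chord _ (be * x + h) (be * y + h) ltac:(nra) ltac:(nra).
rewrite (argmax_eq be0 mx) (argmax_eq be0 my).
have cx := cosh_gt0 (be * x + h); have cy := cosh_gt0 (be * y + h).
have : 0 < cosh (be * x + h) * cosh (be * y + h) by rewrite mulr_gt0.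
have : 0 < h * (y - x) by nra.
nra.
Qed.

Lemma argmaxN be h m : is_argmax be h m -> is_argmax be (- h) (- m).
Proof.
have phiN x : phi0 be (- h) (- x) = phi0 be h x.
  by rewrite /phi0 mulrN -opprD coshN sqrrN.
by move=> mmax x; rewrite -[x]opprK !phiN.
Qed.

Lemma argmax_uniq be h x y : 0 < be -> be <= 1 \/ h != 0 ->
  is_argmax be h x -> is_argmax be h y -> x = y.
Proof.
move=> be0 hyp.
have main u v : is_argmax be h u -> is_argmax be h v -> u < v -> False.
  case: hyp => [|h0]; first exact: argmax_uniq_le1.
  case: (ltgtP h 0) h0 => // h0 _; last exact: argmax_uniq_pos.
  move=> /argmaxN mu /argmaxN mv uv.
  by apply: (@argmax_uniq_pos be (- h) (- v) (- u)) => //; lra.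
by move=> mx my; case: (ltgtP x y) => // xy; [case: (main x y)|case: (main y x)].
Qed.

(** The default value of [xget] never occurs, since a maximizer exists. *)
Lemma m0_argmax be h : 0 < be -> is_argmax be h (m0 be h).
Proof.
move=> be0; rewrite /m0; case: xgetP => [m _ //|nex].
by case: (argmax_exists h be0) => m /nex.
Qed.

Lemma norm_m0_le1 be h : 0 < be -> `|m0 be h| <= 1.
Proof. by move=> be0; apply: argmax_norm_le1 (m0_argmax h be0). Qed.

Lemma phi0_gap be h (d : R) : 0 < be -> be <= 1 \/ h != 0 -> 0 < d ->
  exists2 B, B < phi0 be h (m0 be h) &
    forall x, `|x| <= 1 -> d <= `|x - m0 be h| -> phi0 be h x <= B.
Proof.
move=> be0 hyp d0; set m := m0 be h.
have mmax : is_argmax be h m := m0_argmax h be0.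
have mle : `|m| <= 1 := norm_m0_le1 h be0.
have lt_phi x : x != m -> phi0 be h x < phi0 be h m.
  move=> xm; rewrite lt_neqAle mmax andbT; apply: contraNneq xm => e.
  by apply/eqP; apply: (@argmax_uniq be h) => // y; rewrite e.
move: mle; rewrite ler_norml => /andP[m1 m2].
(* Points of [[-1, 1]] at distance at least [d] from [m] lie in one of two compact intervals. The
   outer ends [- 1 - d] and [1 + d] keep both nonempty, as [|m| <= 1]. By uniqueness each interval
   has a maximum strictly below [phi0 be h m]. *)
have [|c1 c1I c1max] := EVT_max _ (@continuous_phi0 be h (- 1 - d) (m - d)).
  by lra.
have [|c2 c2I c2max] := EVT_max _ (@continuous_phi0 be h (m + d) (1 + d)).
  by lra.
move: c1I c2I; rewrite !in_itv/= => /andP[_ c1m] /andP[c2m _].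
exists (Num.max (phi0 be h c1) (phi0 be h c2)).
  rewrite gt_max !lt_phi //; first by rewrite gt_eqF//; lra.
  by rewrite lt_eqF//; lra.
move=> x; rewrite ler_norml => /andP[x1 x2]; rewrite le_max.
case: (ger0P (x - m)) => xm dx; apply/orP; [right|left].
  by apply: c2max; rewrite in_itv/=; apply/andP; split; lra.
by apply: c1max; rewrite in_itv/=; apply/andP; split; lra.
Qed.

End MeanFieldMagnetization.

(** * Two-sided bounds on the partition function for fixed patterns *)

Section PartitionFunction.
Context {R : realType}.

Lemma spin_sq b : spin R b * spin R b = 1.
Proof. by case: b; rewrite /spin ?mulr1 // mulrNN mulr1. Qed.

Lemma norm_spin b : `|spin R b| = 1.
Proof. by case: b; rewrite /spin ?normrN normr1. Qed.

Lemma spinM b c : spin R b * spin R c = 2 * (b == c)%:R - 1.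
Proof. by case: b; case: c; rewrite /spin /=; lra. Qed.

Lemma sum_ltn_pairs N (a : 'I_N -> R) : (forall i, a i * a i = 1) ->
  \sum_(i < N) \sum_(j < N | (i < j)%N) a i * a j
  = ((\sum_(i < N) a i) ^+ 2 - N%:R) / 2.
Proof.
move=> a1; set T := LHS.
have e : \sum_(i < N) \sum_(j < N | (j < i)%N) a i * a j = T.
  rewrite (exchange_big_dep predT) //=; apply: eq_bigr => i _.
  by apply: eq_bigr => j _; rewrite mulrC.
suff -> : (\sum_(i < N) a i) ^+ 2 = T + N%:R + T by field.
rewrite -{2}e expr2 big_distrlr /=.
have -> : N%:R = \sum_(i < N) a i * a i.
  by under eq_bigr do rewrite a1; rewrite sumr_const card_ord.
rewrite -!big_split/=; apply: eq_bigr => i _.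
rewrite (bigID (fun j : 'I_N => (i < j)%N))/= -addrA; congr (_ + _).
rewrite (bigD1 i) ?ltnn //=; congr (_ + _); apply: eq_bigl => j.
by rewrite -leqNgt andbC ltn_neqAle.
Qed.

Variables (N M : nat) (be la : R).
Hypotheses (N0 : (0 < N)%N) (be0 : 0 < be).
Implicit Types (S : tset N M) (xi : config N) (p : 'I_M -> R).

Definition energy S xi : R :=
  be / N%:R * (\sum_(mu < M) \sum_(i < N) \sum_(j < N | (i < j)%N)
     spin R (S mu i) * spin R (S mu j) * spin R (xi i) * spin R (xi j))
  + la * \sum_(i < N) spin R (xi i).

(** The Mattis magnetizations of [xi] along the patterns. *)
Definition overlap S xi (mu : 'I_M) : R :=
  N%:R^-1 * \sum_(i < N) spin R (S mu i) * spin R (xi i).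

(* The Hubbard-Stratonovich transform of [log Z / N] at the patterns [S]. *)
Definition Gfun S p : R :=
  ln 2 - be * (\sum_(mu < M) p mu ^+ 2) / 2
  + N%:R^-1 * \sum_(i < N)
      ln (cosh (be * (\sum_(mu < M) spin R (S mu i) * p mu) + la)).

Let NR0 : N%:R != 0 :> R. Proof. by rewrite pnatr_eq0 -lt0n. Qed.

(** A sum over pairs is half of a square minus its diagonal; the [M] diagonals produce the constant
    [be * M / 2]. *)
Lemma energy_overlap S xi :
  energy S xi = N%:R * be / 2 * (\sum_(mu < M) overlap S xi mu ^+ 2)
    - be * M%:R / 2 + la * \sum_(i < N) spin R (xi i).
Proof.
rewrite /energy; congr (_ + _).
have e mu : \sum_(i < N) \sum_(j < N | (i < j)%N)
     spin R (S mu i) * spin R (S mu j) * spin R (xi i) * spin R (xi j)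
   = N%:R ^+ 2 / 2 * overlap S xi mu ^+ 2 - N%:R / 2.
  under eq_bigr => i _ do under eq_bigr => j _ do rewrite -mulrA mulrACA.
  rewrite (sum_ltn_pairs (a := fun i => spin R (S mu i) * spin R (xi i))).
    by rewrite /overlap; field.
  by move=> i; rewrite mulrACA !spin_sq mulr1.
under eq_bigr do rewrite e.
rewrite big_split/= -mulr_sumr sumr_const card_ord -[(- _) *+ _]mulr_natr.
by field.
Qed.

(** Completing the square, [q ^ 2 = 2 p q - p ^ 2 + (q - p) ^ 2]. The first sum is linear in the
    spins of [xi], so its exponential factors over sites; the last term is nonnegative and vanishes
    when [p] is the overlap. *)
Lemma energy_linearized S xi p :
  energy S xi = \sum_(i < N)
      (be * (\sum_(mu < M) spin R (S mu i) * p mu) + la) * spin R (xi i)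
    - N%:R * be / 2 * (\sum_(mu < M) p mu ^+ 2) - be * M%:R / 2
    + N%:R * be / 2 * (\sum_(mu < M) (overlap S xi mu - p mu) ^+ 2).
Proof.
have -> : \sum_(mu < M) (overlap S xi mu - p mu) ^+ 2
  = \sum_(mu < M) overlap S xi mu ^+ 2 + \sum_(mu < M) p mu ^+ 2
    - 2 * \sum_(mu < M) overlap S xi mu * p mu.
  rewrite mulr_sumr -sumrN -!big_split/=; apply: eq_bigr => mu _; ring.
have -> : \sum_(i < N)
      (be * (\sum_(mu < M) spin R (S mu i) * p mu) + la) * spin R (xi i)
   = N%:R * be * (\sum_(mu < M) overlap S xi mu * p mu)
     + la * \sum_(i < N) spin R (xi i).
  under eq_bigr do rewrite mulrDl.
  rewrite big_split/= -mulr_sumr; congr (_ + _).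
  under eq_bigr do rewrite -mulrA mulr_suml.
  rewrite -mulr_sumr [N%:R * be]mulrC -mulrA; congr (_ * _).
  rewrite exchange_big/= mulr_sumr; apply: eq_bigr => mu _.
  rewrite /overlap !mulrA divff // mul1r mulr_suml.
  by apply: eq_bigr => i _; rewrite mulrAC.
by rewrite energy_overlap; field.
Qed.

Lemma sum_expR_linear (c : 'I_N -> R) :
  \sum_(xi : config N) expR (\sum_(i < N) c i * spin R (xi i))
  = expR (N%:R * ln 2 + \sum_(i < N) ln (cosh (c i))).
Proof.
under eq_bigr do rewrite expR_sum.
rewrite -(bigA_distr_bigA (fun i b => expR (c i * spin R b))).
have -> : N%:R * ln 2 = \sum_(i < N) ln 2 :> R.
  by rewrite sumr_const card_ord mulr_natl.
rewrite -big_split/= expR_sum; apply: eq_bigr => i _.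
rewrite expRD !lnK ?posrE ?cosh_gt0 //.
by rewrite big_bool /spin /cosh mulr1 mulrN1 /=; field.
Qed.

Lemma sum_expR_Gfun S p :
  \sum_(xi : config N)
     expR (\sum_(i < N)
      (be * (\sum_(mu < M) spin R (S mu i) * p mu) + la) * spin R (xi i)
    - N%:R * be / 2 * (\sum_(mu < M) p mu ^+ 2) - be * M%:R / 2)
  = expR (N%:R * Gfun S p - be * M%:R / 2).
Proof.
under eq_bigr do rewrite -addrA expRD.
rewrite -mulr_suml sum_expR_linear -expRD /Gfun; congr expR.
by field.
Qed.

Lemma Zpart_ge S p :
  expR (N%:R * Gfun S p - be * M%:R / 2) <= Zpart be la S.
Proof.
rewrite -sum_expR_Gfun; apply: ler_sum => xi _.
rewrite -/(energy S xi) (energy_linearized S xi p) ler_expR lerDl.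
rewrite mulr_ge0 //; last by apply: sumr_ge0 => mu _; exact: sqr_ge0.
by rewrite mulr_ge0 // mulr_ge0 // ltW.
Qed.

(** An affine recoding of the overlaps with values in a finite type, so that their possible values
    can be counted: there are [(N + 1) ^ M] of them. The counts are at most [N], hence [inord] does
    not truncate. *)
Definition agreements S xi : {ffun 'I_M -> 'I_N.+1} :=
  [ffun mu => inord #|[pred i | S mu i == xi i]|].

Lemma overlap_agreements S xi xi' :
  agreements S xi = agreements S xi' -> overlap S xi =1 overlap S xi'.
Proof.
have ov x mu : overlap S x mu = 2 * (agreements S x mu)%:R / N%:R - 1.
  rewrite /overlap ffunE inordK; last first.
    by rewrite ltnS -[X in (_ <= X)%N]card_ord max_card.
  under eq_bigr do rewrite spinM.
  have -> : \sum_(i < N) (2 * (S mu i == x i)%:R - 1)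
      = 2 * #|[pred i | S mu i == x i]|%:R - N%:R :> R.
    rewrite big_split/= -mulr_sumr sumrN sumr_const card_ord.
    rewrite -sum1_card natr_sum [in RHS]big_mkcond; congr (2 * _ - _).
    by apply: eq_bigr => i _; rewrite inE; case: eqP.
  by field.
by move=> e mu; rewrite !ov e.
Qed.

(* Only [(N + 1) ^ M] values of the overlaps occur, and at its own overlap
   the energy of a configuration equals its linearization. *)
Lemma sum_expR_energy_le S (Q : pred (config N)) (B : R) :
  (forall xi, Q xi -> Gfun S (overlap S xi) <= B) ->
  \sum_(xi : config N | Q xi) expR (energy S xi)
  <= (N.+1 ^ M)%:R * expR (N%:R * B - be * M%:R / 2).
Proof.
move=> QB; rewrite (partition_big (agreements S) predT) //=.
apply: (@le_trans _ _
  (\sum_(k : {ffun 'I_M -> 'I_N.+1}) expR (N%:R * B - be * M%:R / 2))); last first.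
  by rewrite sumr_const card_ffun !card_ord -[leLHS]mulr_natl.
apply: ler_sum => k _.
(* A representative [xi0] of the class supplies the point of linearization; an empty class
   contributes 0. *)
have [xi0 /andP[Q0 /eqP k0]|none] := pickP [pred xi | Q xi & agreements S xi == k];
  last by rewrite big_pred0 ?expR_ge0.
(* All members of the class share the overlaps of [xi0], so the linearization there is exact on the
   class. Extending the sum of linearized weights to all configurations then only increases it and
   gives [exp (N * Gfun)]. *)
apply: (@le_trans _ _ (expR (N%:R * Gfun S (overlap S xi0) - be * M%:R / 2))).
  rewrite -sum_expR_Gfun big_mkcond/=; apply: ler_sum => xi _.
  case: ifP => [/andP[_ /eqP kxi]|_]; last exact: expR_ge0.
  rewrite (energy_linearized S xi (overlap S xi0)) ler_expR gerDl.
  rewrite big1 ?mulr0 // => mu _.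
  by rewrite (@overlap_agreements S xi xi0) ?subrr ?expr0n // kxi k0.
by rewrite ler_expR lerD2r ler_pM2l ?ltr0n ?QB.
Qed.

Lemma norm_overlap_le1 S xi mu : `|overlap S xi mu| <= 1.
Proof.
rewrite /overlap normrM ger0_norm ?invr_ge0 ?ler0n //.
rewrite mulrC ler_pdivrMr ?ltr0n // mul1r.
apply: (le_trans (ler_norm_sum _ _ _)).
under eq_bigr do rewrite normrM !norm_spin mulr1.
by rewrite sumr_const card_ord.
Qed.

End PartitionFunction.

(** * Concentration of the Curie-Weiss magnetization at [m0] *)

Section CurieWeissConcentration.
Context {R : realType}.

Definition cw_weight N (be h : R) (s : config N) : R :=
  expR (cw_exponent be h s) / cw_z N be h.

Definition cw_mean N (be h : R) (f : config N -> R) : R :=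
  \sum_(s : config N) cw_weight be h s * f s.

Definition magnetization N (s : config N) : R :=
  N%:R^-1 * \sum_(i < N) spin R (s i).

(** With this single all-up pattern, and [h] in the place of [la], the energy is the Curie-Weiss
    exponent and the overlap is the magnetization; the bounds on [Zpart] thus apply to [cw_z]. *)
Definition trivial_pattern N : tset N 1 := [ffun _ => [ffun _ => true]].

Section FixedSize.
Variables (N : nat) (be h : R).

Lemma cw_z_gt0 : 0 < cw_z N be h.
Proof.
rewrite /cw_z (bigD1 [ffun _ => true]) //=.
by rewrite ltr_pwDl ?expR_gt0 // sumr_ge0 // => s _; exact: expR_ge0.
Qed.

Lemma cw_weight_ge0 (s : config N) : 0 <= cw_weight be h s.
Proof. by rewrite divr_ge0 ?expR_ge0 // ltW // cw_z_gt0. Qed.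

Lemma sum_cw_weight : \sum_(s : config N) cw_weight be h s = 1.
Proof. by rewrite -mulr_suml divff // gt_eqF // cw_z_gt0. Qed.

Lemma cw_mean_cst (c : R) : cw_mean be h (fun _ : config N => c) = c.
Proof. by rewrite /cw_mean -mulr_suml sum_cw_weight mul1r. Qed.

Lemma cw_meanD (f g : config N -> R) :
  cw_mean be h (fun s => f s + g s) = cw_mean be h f + cw_mean be h g.
Proof. by rewrite -big_split; apply: eq_bigr => s _; rewrite mulrDr. Qed.

Lemma cw_meanZ c (f : config N -> R) :
  cw_mean be h (fun s => c * f s) = c * cw_mean be h f.
Proof. by rewrite mulr_sumr; apply: eq_bigr => s _; rewrite mulrCA. Qed.

Lemma cw_mean_le (f g : config N -> R) :
  (forall s, f s <= g s) -> cw_mean be h f <= cw_mean be h g.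
Proof. by move=> fg; apply: ler_sum => s _; rewrite ler_wpM2l ?cw_weight_ge0. Qed.

Lemma norm_cw_mean_le (f : config N -> R) :
  `|cw_mean be h f| <= cw_mean be h (fun s => `|f s|).
Proof.
apply: (le_trans (ler_norm_sum _ _ _)); apply: ler_sum => s _.
by rewrite normrM (ger0_norm (cw_weight_ge0 s)).
Qed.

Lemma cw_exponent_energy s : cw_exponent be h s = energy be h (trivial_pattern N) s.
Proof.
rewrite /cw_exponent /energy big_ord1.
congr (_ * _ + _); apply: eq_bigr => i _; apply: eq_bigr => j _.
by rewrite !ffunE /spin !mul1r.
Qed.

Lemma overlap_magnetization s mu : overlap (trivial_pattern N) s mu = magnetization s.
Proof.
by congr (_ * _); apply: eq_bigr => i _; rewrite !ffunE /spin mul1r.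
Qed.

Hypothesis N0 : (0 < N)%N.

Lemma Gfun_phi0 p : Gfun be h (trivial_pattern N) p = phi0 be h (p ord0).
Proof.
have NR0 : N%:R != 0 :> R by rewrite pnatr_eq0 -lt0n.
rewrite /Gfun /phi0 big_ord1.
have -> : \sum_(i < N) ln (cosh
     (be * (\sum_(mu < 1) spin R (trivial_pattern N mu i) * p mu) + h))
   = N%:R * ln (cosh (be * p ord0 + h)).
  under eq_bigr do rewrite big_ord1 !ffunE /spin mul1r.
  by rewrite sumr_const card_ord mulr_natl.
by rewrite mulKf //; ring.
Qed.

Lemma norm_magnetization_le1 (s : config N) : `|magnetization s| <= 1.
Proof. by rewrite -(overlap_magnetization s ord0) norm_overlap_le1. Qed.

Hypothesis be0 : 0 < be.

(** The numerator is bounded above by counting magnetizations, the normalization [cw_z] below by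
    linearizing at [m]; the constants [be / 2] cancel in the ratio. *)
Lemma cw_tail (Q : pred R) (m B : R) :
  (forall x, `|x| <= 1 -> Q x -> phi0 be h x <= B) ->
  \sum_(s : config N | Q (magnetization s)) cw_weight be h s
  <= N.+1%:R * expR (- (N%:R * (phi0 be h m - B))).
Proof.
move=> QB; rewrite -mulr_suml ler_pdivrMr ?cw_z_gt0 //.
apply: (@le_trans _ _ (N.+1%:R * expR (N%:R * B - be / 2))).
  under eq_bigr do rewrite cw_exponent_energy.
  have := @sum_expR_energy_le R N 1 be h N0 (trivial_pattern N)
    (fun s => Q (magnetization s)) B.
  rewrite expn1 mulr1; apply => s Qs.
  by rewrite Gfun_phi0 overlap_magnetization QB // norm_magnetization_le1.
rewrite -mulrA ler_pM2l ?ltr0n //.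
have -> : N%:R * B - be / 2
  = - (N%:R * (phi0 be h m - B)) + (N%:R * phi0 be h m - be / 2) by ring.
rewrite expRD ler_pM2l ?expR_gt0 //.
have := @Zpart_ge R N 1 be h N0 be0 (trivial_pattern N) (fun=> m).
rewrite Gfun_phi0 mulr1 => /le_trans; apply; apply: ler_sum => s _.
by rewrite -/(energy be h (trivial_pattern N) s) -cw_exponent_energy.
Qed.

End FixedSize.

Lemma cvg_linear_expRN (c : R) : 0 < c ->
  (fun N : nat => N.+1%:R * expR (- (N%:R * c))) @ \oo --> (0 : R).
Proof.
(* The quadratic lower bound on [exp] suffices: this [K] makes [K * (1 + (N c) ^ 2 / 2) >= 2 + 2 N ^
   2 >= (N + 1) ^ 2], so the sequence is at most [K / (N + 1)]. *)
move=> c0; set K := 2 + 4 / c ^+ 2.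
apply: (@squeeze_cvgr _ _ _ _ (cst 0) (fun N => K * harmonic N)).
- near=> N; rewrite mulr_ge0 ?expR_ge0 //= /harmonic expRN.
  rewrite ler_pdivrMr ?expR_gt0 // mulrAC ler_pdivlMr ?ltr0n //.
  have := @expR_ge1Dxn R (N%:R * c) 1 ltac:(rewrite mulr_ge0 ?ler0n // ltW//).
  move=> /(ler_wpM2l (_ : 0 <= K)) H.
  have K0 : 0 <= K by rewrite addr_ge0 // divr_ge0 // sqr_ge0.
  apply: le_trans (H K0).
  have -> : K * (1 + (N%:R * c) ^+ 2 / 2`!%:R)
     = 2 + 2 * N%:R ^+ 2 + (4 / c ^+ 2 + c ^+ 2 * N%:R ^+ 2).
    by rewrite /K (_ : 2`! = 2%N) //; field; rewrite gt_eqF.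
  have := sqr_ge0 (N%:R - 1 : R).
  have : 0 <= 4 / c ^+ 2 + c ^+ 2 * N%:R ^+ 2.
    by apply: addr_ge0; [apply: divr_ge0|apply: mulr_ge0]; rewrite ?sqr_ge0 ?ler0n.
  by rewrite -natr1; nra.
- exact: cvg_cst.
- rewrite -(mulr0 K); apply: cvgM; [exact: cvg_cst|exact: cvg_harmonic].
Unshelve. all: by end_near.
Qed.

Variables (be h : R).
Hypotheses (be0 : 0 < be) (uniq : be <= 1 \/ h != 0).

(** Split at deviation [e / 2]. Smaller deviations contribute at most [e / 2]; larger ones are at
    most 2 and have probability at most [e / 4] for large [N], by the gap of [phi0] and
    [cw_tail]. *)
Lemma magnetization_cvg :
  (fun N => cw_mean be h (fun s : config N => `|magnetization s - m0 be h|))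
    @ \oo --> (0 : R).
Proof.
apply/cvgrPdist_le => e e0.
have [|B Bm BP] := @phi0_gap _ be h (e / 2) be0 uniq; first by lra.
have c0 : 0 < phi0 be h (m0 be h) - B by lra.
have /cvgrPdist_le /(_ (e / 4)) : (fun N : nat => N.+1%:R *
  expR (- (N%:R * (phi0 be h (m0 be h) - B)))) @ \oo --> (0 : R).
  exact: cvg_linear_expRN.
move=> /(_ ltac:(lra)) small; near=> N.
have N0 : (0 < N)%N by near: N; exact: nbhs_infty_gt.
have := @cw_tail N be h N0 be0 (fun x => e / 2 <= `|x - m0 be h|) (m0 be h) B BP.
have : `|0 - N.+1%:R * expR (- (N%:R * (phi0 be h (m0 be h) - B)))| <= e / 4.
  by near: N.
rewrite sub0r normrN ger0_norm ?mulr_ge0 ?expR_ge0 // => se st.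
rewrite sub0r normrN ger0_norm; last first.
  by apply: sumr_ge0 => s _; rewrite mulr_ge0 ?cw_weight_ge0.
apply: (@le_trans _ _ (\sum_(s : config N) (cw_weight be h s * (e / 2) +
   2 * (if e / 2 <= `|magnetization s - m0 be h| then cw_weight be h s else 0)))).
  apply: ler_sum => s _; have w0 := cw_weight_ge0 be h s.
  case: (lerP (e / 2) `|magnetization s - m0 be h|) => es.
    have : `|magnetization s - m0 be h| <= 2.
      apply: (le_trans (ler_normB _ _)).
      by have := norm_magnetization_le1 N0 s; have := norm_m0_le1 h be0; lra.
    by move=> /(ler_wpM2l w0); nra.
  by have := ler_wpM2l w0 (ltW es); rewrite mulr0 addr0.
rewrite big_split/= -mulr_suml sum_cw_weight -mulr_sumr -big_mkcond /=.
by lra.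
Unshelve. all: by end_near.
Qed.

Lemma cw_mean_magnetization_cvg :
  (fun N => cw_mean be h (@magnetization N)) @ \oo --> m0 be h.
Proof.
have /cvgrPdist_le H := magnetization_cvg; apply/cvgrPdist_le => e e0.
near=> N.
have : `|0 - cw_mean be h (fun s : config N => `|magnetization s - m0 be h|)| <= e.
  by near: N; exact: H.
rewrite sub0r normrN => /(le_trans (ler_norm _)); apply: le_trans.
rewrite distrC -{1}(@cw_mean_cst N be h (m0 be h)) -mulN1r -cw_meanZ -cw_meanD.
rewrite (le_trans (norm_cw_mean_le _ _ _)) //; apply: cw_mean_le => s.
by rewrite mulN1r.
Unshelve. all: by end_near.
Qed.

Lemma cw_mean_sqr_magnetization_cvg :
  (fun N => cw_mean be h (fun s : config N => magnetization s ^+ 2))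
    @ \oo --> m0 be h ^+ 2.
Proof.
have /cvgrPdist_le H := magnetization_cvg; apply/cvgrPdist_le => e e0.
near=> N.
have N0 : (0 < N)%N by near: N; exact: nbhs_infty_gt.
have : `|0 - cw_mean be h (fun s : config N => `|magnetization s - m0 be h|)| <= e / 2.
  by near: N; apply: H; lra.
rewrite sub0r normrN => /(le_trans (ler_norm _)) He.
rewrite distrC -{1}(@cw_mean_cst N be h (m0 be h ^+ 2)) -mulN1r -cw_meanZ -cw_meanD.
(* The factor 2 bounds [|magnetization s + m0 be h|] in the factored difference of squares. *)
apply: (@le_trans _ _ (2 * cw_mean be h (fun s : config N => `|magnetization s - m0 be h|))).
  rewrite -cw_meanZ (le_trans (norm_cw_mean_le _ _ _)) //; apply: cw_mean_le => s.
  rewrite mulN1r subr_sqr normrM mulrC ler_wpM2r // (le_trans (ler_normD _ _)) //.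
  by have := norm_magnetization_le1 N0 s; have := norm_m0_le1 h be0; lra.
by lra.
Unshelve. all: by end_near.
Qed.

End CurieWeissConcentration.

(** * Exchangeability: spin moments from moments of the magnetization *)

Section Exchangeability.
Context {R : realType}.
Variables (N : nat) (be h : R).

(** In this form the exponent depends on [s] only through its total spin, which makes the measure
    invariant under permutations of the sites. *)
Lemma cw_exponent_sum (s : config N) :
  cw_exponent be h s =
  be / N%:R * (((\sum_(i < N) spin R (s i)) ^+ 2 - N%:R) / 2)
  + h * \sum_(i < N) spin R (s i).
Proof.
by rewrite /cw_exponent (sum_ltn_pairs (a := fun i => spin R (s i))) // => i;
  rewrite spin_sq.
Qed.

Definition permute (sg : {perm 'I_N}) (s : config N) : config N := [ffun i => s (sg i)].

Lemma sum_permute sg s : \sum_(i < N) spin R (permute sg s i) = \sum_(i < N) spin R (s i).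
Proof.
rewrite [RHS](reindex_inj (@perm_inj _ sg)).
by apply: eq_bigr => i _; rewrite ffunE.
Qed.

Lemma permute_inj sg : injective (permute sg).
Proof.
move=> s t /ffunP e; apply/ffunP => i.
by have := e ((sg^-1)%g i); rewrite !ffunE permKV.
Qed.

Lemma cw_mean_permute sg (f : config N -> R) :
  cw_mean be h f = cw_mean be h (fun s => f (permute sg s)).
Proof.
rewrite /cw_mean (reindex_inj (@permute_inj sg)); apply: eq_bigr => s _.
by rewrite /cw_weight !cw_exponent_sum sum_permute.
Qed.

Lemma cw_mean_sum I (r : seq I) (P : pred I) (f : I -> config N -> R) :
  cw_mean be h (fun s => \sum_(i <- r | P i) f i s) =
  \sum_(i <- r | P i) cw_mean be h (f i).
Proof.
rewrite /cw_mean exchange_big/=; apply: eq_bigr => s _.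
by rewrite mulr_sumr.
Qed.

Lemma eq_cw_mean (f g : config N -> R) : f =1 g -> cw_mean be h f = cw_mean be h g.
Proof. by move=> fg; apply: eq_bigr => s _; rewrite fg. Qed.

Hypothesis N0 : (0 < N)%N.
Let NR0 : N%:R != 0 :> R. Proof. by rewrite pnatr_eq0 -lt0n. Qed.

Lemma cw_mean_spin i :
  cw_mean be h (fun s : config N => spin R (s i)) = cw_mean be h (@magnetization R N).
Proof.
rewrite /magnetization cw_meanZ cw_mean_sum.
rewrite (eq_bigr (fun=> cw_mean be h (fun s : config N => spin R (s i)))); last first.
  move=> j _; rewrite (cw_mean_permute (tperm i j)).
  by apply: eq_cw_mean => s; rewrite ffunE tpermR.
by rewrite sumr_const card_ord -[X in _ * X]mulr_natl mulKf.
Qed.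

(** The mean of [N * magnetization ^ 2] is the average of the rows [row k], which are all equal by
    exchangeability. Row [i] consists of the diagonal term 1 and of [N - 1] equal correlations. *)
Lemma cw_mean_spin_pair i j : i != j ->
  (N%:R - 1) * cw_mean be h (fun s : config N => spin R (s i) * spin R (s j))
  = N%:R * cw_mean be h (fun s : config N => magnetization s ^+ 2) - 1.
Proof.
move=> ij.
pose row k := cw_mean be h
  (fun s : config N => spin R (s k) * \sum_(l < N) spin R (s l)).
have row_eq k : row k = row i.
  rewrite /row (cw_mean_permute (tperm i k)); apply: eq_cw_mean => s.
  by rewrite sum_permute ffunE tpermR.
have -> : N%:R * cw_mean be h (fun s : config N => magnetization s ^+ 2) = row i.
  rewrite -cw_meanZ.
  have -> : cw_mean be h (fun s : config N => N%:R * magnetization s ^+ 2)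
    = N%:R^-1 * \sum_(k < N) row k.
    rewrite -cw_mean_sum -cw_meanZ; apply: eq_cw_mean => s.
    by rewrite -mulr_suml /magnetization; field.
  rewrite (eq_bigr _ (fun k _ => row_eq k)) sumr_const card_ord.
  by rewrite -[X in _ * X]mulr_natl mulKf.
have -> : row i = \sum_(l < N) cw_mean be h
    (fun s : config N => spin R (s i) * spin R (s l)).
  by rewrite -cw_mean_sum; apply: eq_cw_mean => s; rewrite mulr_sumr.
rewrite (bigD1 i)//=.
rewrite [X in X + _ - 1](_ : _ = 1); last first.
  rewrite -[RHS](@cw_mean_cst R N be h); apply: eq_cw_mean => s.
  by rewrite spin_sq.
rewrite addrAC subrr add0r.
rewrite (eq_bigr (fun=> cw_mean be h (fun s : config N => spin R (s i) * spin R (s j)))).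
  rewrite sumr_const cardC1 card_ord -[in RHS]mulr_natl; congr (_ * _).
  by rewrite -subn1 natrB.
move=> l li; rewrite (cw_mean_permute (tperm j l)); apply: eq_cw_mean => s.
by rewrite !ffunE tpermR tpermD // eq_sym.
Qed.

End Exchangeability.

(** * First two moments of the empirical law of the columns *)

Section EmpiricalLaw.
Context {R : realType}.
Variables (M : nat) (be h : R).
Implicit Types t : {ffun 'I_M -> bool}.

(** The field is the same for all patterns; arbitrary signs are reduced to this case by gauge
    invariance. *)
Definition tset_mean N (F : tset N M -> R) : R :=
  \sum_(S : tset N M) P_CW be (fun=> h) S * F S.

(* The proportion of sites [i] whose column [(S mu i)_mu] is [t]. *)
Definition empirical N (S : tset N M) t : R :=
  N%:R^-1 * \sum_(i < N) \prod_(mu < M) ((1 + spin R (S mu i) * spin R (t mu)) / 2).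

Definition column_law t : R := \prod_(mu < M) ((1 + m0 be h * spin R (t mu)) / 2).

Lemma tset_mean_prod N (f : 'I_M -> config N -> R) :
  tset_mean (fun S : tset N M => \prod_(mu < M) f mu (S mu))
  = \prod_(mu < M) cw_mean be h (f mu).
Proof.
rewrite /cw_mean bigA_distr_bigA /tset_mean; apply: eq_bigr => S _.
by rewrite -big_split.
Qed.

Lemma P_CW_ge0 N (S : tset N M) : 0 <= P_CW be (fun=> h) S.
Proof. by apply: prodr_ge0 => mu _; exact: cw_weight_ge0. Qed.

Lemma sum_P_CW N : \sum_(S : tset N M) P_CW be (fun=> h) S = 1.
Proof.
transitivity (tset_mean (fun S : tset N M =>
    \prod_(mu < M) (fun=> 1 : R) (S mu))).
  by apply: eq_bigr => S _; rewrite big1 ?mulr1.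
rewrite (tset_mean_prod (fun _ _ => 1)) big1 // => mu _.
exact: cw_mean_cst.
Qed.

Lemma tset_meanD N (F G : tset N M -> R) :
  tset_mean (fun S => F S + G S) = tset_mean F + tset_mean G.
Proof. by rewrite -big_split; apply: eq_bigr => S _; rewrite mulrDr. Qed.

Lemma tset_meanZ N c (F : tset N M -> R) :
  tset_mean (fun S => c * F S) = c * tset_mean F.
Proof. by rewrite mulr_sumr; apply: eq_bigr => S _; rewrite mulrCA. Qed.

Lemma tset_mean_cst N c : tset_mean (fun _ : tset N M => c) = c.
Proof. by rewrite /tset_mean -mulr_suml sum_P_CW mul1r. Qed.

Lemma tset_mean_affine N a c (F : tset N M -> R) :
  tset_mean (fun S => a + c * F S) = a + c * tset_mean F.
Proof. by rewrite tset_meanD tset_mean_cst tset_meanZ. Qed.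

Lemma tset_mean_le N (F G : tset N M -> R) :
  (forall S, F S <= G S) -> tset_mean F <= tset_mean G.
Proof. by move=> FG; apply: ler_sum => S _; rewrite ler_wpM2l ?P_CW_ge0. Qed.

Lemma tset_mean_sum N I (r : seq I) (P : pred I) (F : I -> tset N M -> R) :
  tset_mean (fun S => \sum_(i <- r | P i) F i S) =
  \sum_(i <- r | P i) tset_mean (F i).
Proof.
rewrite /tset_mean exchange_big/=; apply: eq_bigr => S _.
by rewrite mulr_sumr.
Qed.

Lemma eq_tset_mean N (F G : tset N M -> R) : F =1 G -> tset_mean F = tset_mean G.
Proof. by move=> FG; apply: eq_bigr => S _; rewrite FG. Qed.

Definition mag1 N := cw_mean be h (@magnetization R N).
Definition mag2 N := cw_mean be h (fun s : config N => magnetization s ^+ 2).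
(** The correlation of two distinct spins, [(N * mag2 - 1) / (N - 1)], written so that its limit is
    that of [mag2]. *)
Definition spin_corr N := mag2 N + (mag2 N - 1) * (N%:R - 1)^-1.
Definition column_mean t N := \prod_(mu < M) ((1 + mag1 N * spin R (t mu)) / 2).
(** The probability that two distinct sites both carry the column [t]; in each factor the square of
    [spin (t mu)] has been replaced by 1. *)
Definition column_pair_mean t N :=
  \prod_(mu < M) ((1 + 2 * mag1 N * spin R (t mu) + spin_corr N) / 4).

Lemma empirical_mean t N : (0 < N)%N ->
  tset_mean (fun S : tset N M => empirical S t) = column_mean t N.
Proof.
move=> N0; rewrite tset_meanZ tset_mean_sum (eq_bigr (fun=> column_mean t N)).
  by rewrite sumr_const card_ord -[X in _ * X]mulr_natl mulKf // pnatr_eq0 -lt0n.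
move=> i _.
rewrite (tset_mean_prod (fun mu s => (1 + spin R (s i) * spin R (t mu)) / 2)).
apply: eq_bigr => mu _; rewrite /mag1 -(cw_mean_spin be h N0 i).
transitivity (cw_mean be h (fun s : config N => 2^-1 * (1 + spin R (t mu) * spin R (s i)))).
  by apply: eq_cw_mean => s; field.
by rewrite cw_meanZ cw_meanD cw_mean_cst cw_meanZ; field.
Qed.

(** The squared sum over sites has [N] diagonal terms, where the squared indicator is the indicator
    itself, and [N * (N - 1)] off-diagonal ones. Independence of the patterns factors each term over
    [mu], leaving one- and two-spin means. *)
Lemma empirical_sqr_mean t N : (1 < N)%N ->
  tset_mean (fun S : tset N M => empirical S t ^+ 2)
  = N%:R^-1 * column_mean t N + (1 - N%:R^-1) * column_pair_mean t N.
Proof.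
move=> N1; have N0 : (0 < N)%N := ltnW N1.
have NR0 : N%:R != 0 :> R by rewrite pnatr_eq0 -lt0n.
have NR1 : N%:R - 1 != 0 :> R by rewrite subr_eq0 pnatr_eq1 gtn_eqF.
pose F mu i (s : config N) : R := (1 + spin R (s i) * spin R (t mu)) / 2.
have FE mu i j : cw_mean be h (fun s => F mu i s * F mu j s)
   = if j == i then (1 + mag1 N * spin R (t mu)) / 2
     else (1 + 2 * mag1 N * spin R (t mu) + spin_corr N) / 4.
  have -> : cw_mean be h (fun s => F mu i s * F mu j s)
     = (1 + 2 * mag1 N * spin R (t mu)
        + cw_mean be h (fun s : config N => spin R (s i) * spin R (s j))) / 4.
    rewrite (@eq_cw_mean _ _ _ _ _ (fun s => 4^-1 * (1 + (spin R (t mu) * spin R (s i)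
        + spin R (t mu) * spin R (s j)) + spin R (s i) * spin R (s j)))); last first.
      move=> s; rewrite /F.
      have -> : (1 + spin R (s i) * spin R (t mu)) / 2 *
                ((1 + spin R (s j) * spin R (t mu)) / 2)
        = 4^-1 * (1 + (spin R (t mu) * spin R (s i) + spin R (t mu) * spin R (s j))
           + (spin R (s i) * spin R (s j)) * (spin R (t mu) * spin R (t mu))) by field.
      by rewrite spin_sq mulr1.
    rewrite cw_meanZ !cw_meanD cw_mean_cst !cw_meanZ !cw_mean_spin // -/(mag1 N).
    by field.
  case: eqP => [->|/eqP ji].
    under eq_cw_mean do rewrite spin_sq.
    by rewrite cw_mean_cst; field.
  congr ((_ + _) / _); apply: (mulfI NR1).
  rewrite cw_mean_spin_pair 1?eq_sym // /spin_corr -/(mag2 N); field.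
  exact: NR1.
have -> : tset_mean (fun S : tset N M => empirical S t ^+ 2)
  = N%:R^-1 ^+ 2 * \sum_(i < N) \sum_(j < N)
      \prod_(mu < M) cw_mean be h (fun s => F mu i s * F mu j s).
  under eq_bigr => i _ do under eq_bigr => j _ do rewrite -tset_mean_prod.
  under eq_bigr => i _ do rewrite -tset_mean_sum.
  rewrite -tset_mean_sum -tset_meanZ; apply: eq_tset_mean => S.
  rewrite /empirical exprMn; congr (_ * _).
  rewrite expr2 big_distrlr/=; apply: eq_bigr => i _; apply: eq_bigr => j _.
  by rewrite -big_split.
rewrite (eq_bigr (fun=> column_mean t N + (N%:R - 1) * column_pair_mean t N)).
  by rewrite sumr_const card_ord -[X in _ * X]mulr_natl; field.
move=> i _; rewrite (bigD1 i)//=; congr (_ + _).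
  by apply: eq_bigr => mu _; rewrite FE eqxx.
rewrite (eq_bigr (fun=> column_pair_mean t N)).
  rewrite sumr_const cardC1 card_ord -[in LHS]mulr_natl; congr (_ * _).
  by rewrite -subn1 natrB.
by move=> j ji; apply: eq_bigr => mu _; rewrite FE (negbTE ji).
Qed.

End EmpiricalLaw.

(** * Convergence in mean of the empirical law to the product law *)

Section EmpiricalLimit.
Context {R : realType}.
Variables (M : nat) (be h : R).
Hypotheses (be0 : 0 < be) (uniq : be <= 1 \/ h != 0).
Implicit Types t : {ffun 'I_M -> bool}.

Lemma cvg_invn : (fun N : nat => N%:R^-1 : R) @ \oo --> (0 : R).
Proof. by rewrite -cvg_shiftS; exact: cvg_harmonic. Qed.

Lemma cvg_inv_predn : (fun N : nat => (N%:R - 1)^-1 : R) @ \oo --> (0 : R).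
Proof.
(* The shift by two turns [N - 1] into [N + 1], the denominator of [harmonic]. *)
rewrite -(cvg_shiftn 2) /=.
have -> : (fun N => ((N + 2)%:R - 1)^-1 : R) = harmonic; last exact: cvg_harmonic.
by apply/funext => N; rewrite /harmonic addn2 -natr1 addrK.
Qed.

Lemma cvg_prod (f : 'I_M -> nat -> R) (l : 'I_M -> R) :
  (forall mu, f mu @ \oo --> l mu) ->
  (fun N => \prod_(mu < M) f mu N) @ \oo --> \prod_(mu < M) l mu.
Proof. by move=> fl; apply: cvg_big => //; exact: mul_continuous. Qed.

Lemma spin_corr_cvg : spin_corr be h @ \oo --> m0 be h ^+ 2.
Proof.
have m2 := cw_mean_sqr_magnetization_cvg be0 uniq.
rewrite -[X in _ --> X]addr0 -(mulr0 (m0 be h ^+ 2 - 1)).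
apply: cvgD; first exact: m2.
apply: cvgM; last exact: cvg_inv_predn.
by apply: cvgB; [exact: m2|exact: cvg_cst].
Qed.

Lemma column_mean_cvg t : column_mean be h t @ \oo --> column_law be h t.
Proof.
apply: cvg_prod => mu; apply: cvgM; last exact: cvg_cst.
apply: cvgD; first exact: cvg_cst.
by apply: cvgM; [exact: cw_mean_magnetization_cvg|exact: cvg_cst].
Qed.

Lemma column_pair_mean_cvg t :
  column_pair_mean be h t @ \oo --> column_law be h t ^+ 2.
Proof.
rewrite /column_law expr2 -big_split /=.
apply: cvg_prod => mu.
have -> : (1 + m0 be h * spin R (t mu)) / 2 * ((1 + m0 be h * spin R (t mu)) / 2)
  = (1 + 2 * m0 be h * spin R (t mu)
     + m0 be h ^+ 2 * (spin R (t mu) * spin R (t mu))) / 4 by field.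
rewrite spin_sq mulr1.
apply: cvgM; last exact: cvg_cst.
apply: cvgD; last exact: spin_corr_cvg.
apply: cvgD; first exact: cvg_cst.
apply: cvgM; last exact: cvg_cst.
by apply: cvgM; [exact: cvg_cst|exact: cw_mean_magnetization_cvg].
Qed.

(** Distinct sites become asymptotically independent: the pair mean tends to [p ^ 2], where [p] is
    the limit of the mean. The expanded square therefore tends to [p ^ 2 - 2 p ^ 2 + p ^ 2 = 0]. *)
Lemma empirical_variance_cvg t :
  (fun N => tset_mean be h (fun S : tset N M =>
     (empirical S t - column_law be h t) ^+ 2)) @ \oo --> (0 : R).
Proof.
set p := column_law be h t.
have lim : (fun N : nat => N%:R^-1 * column_mean be h t N
    + (1 - N%:R^-1) * column_pair_mean be h t N - 2 * p * column_mean be h t N + p ^+ 2)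
    @ \oo --> (0 * p + (1 - 0) * p ^+ 2 - 2 * p * p + p ^+ 2 : R).
  apply: cvgD; last exact: cvg_cst.
  apply: cvgB; last by apply: cvgM; [exact: cvg_cst|exact: column_mean_cvg].
  apply: cvgD; apply: cvgM.
  - exact: cvg_invn.
  - exact: column_mean_cvg.
  - by apply: cvgB; [exact: cvg_cst|exact: cvg_invn].
  - exact: column_pair_mean_cvg.
have e0 : 0 * p + (1 - 0) * p ^+ 2 - 2 * p * p + p ^+ 2 = 0 by ring.
rewrite -[X in _ --> X]e0; apply: cvg_trans lim; apply: near_eq_cvg.
near=> N.
have N1 : (1 < N)%N by near: N; exact: nbhs_infty_gt.
rewrite -empirical_sqr_mean // -(@empirical_mean _ _ be h t N (ltnW N1)).
rewrite -(@tset_mean_cst _ M be h N (p ^+ 2)) -mulNr -tset_meanZ -!tset_meanD.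
by apply: eq_tset_mean => S; ring.
Unshelve. all: by end_near.
Qed.

Lemma empirical_cvg t :
  (fun N => tset_mean be h (fun S : tset N M =>
     `|empirical S t - column_law be h t|)) @ \oo --> (0 : R).
Proof.
apply/cvgrPdist_le => e e0.
have /cvgrPdist_le /(_ (e ^+ 2)) := empirical_variance_cvg t.
rewrite exprn_gt0 // => /(_ isT) H; near=> N.
have : `|0 - tset_mean be h (fun S : tset N M =>
     (empirical S t - column_law be h t) ^+ 2)| <= e ^+ 2 by near: N.
rewrite sub0r normrN => /(le_trans (ler_norm _)) V.
rewrite sub0r normrN ger0_norm; last first.
  by apply: sumr_ge0 => S _; rewrite mulr_ge0 // P_CW_ge0.
(* AM-GM: [|x| <= (e + x^2 / e) / 2] *)
apply: (@le_trans _ _ (tset_mean be h (fun S : tset N M =>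
  e / 2 + (2 * e)^-1 * (empirical S t - column_law be h t) ^+ 2))).
  apply: tset_mean_le => S; set x := empirical S t - _.
  have -> : x ^+ 2 = `|x| ^+ 2 by rewrite real_normK ?num_real.
  rewrite -subr_ge0.
  have -> : e / 2 + (2 * e)^-1 * `|x| ^+ 2 - `|x| = (2 * e)^-1 * (e - `|x|) ^+ 2.
    by field; rewrite gt_eqF.
  by rewrite mulr_ge0 ?sqr_ge0 // invr_ge0 mulr_ge0 // ltW.
rewrite tset_meanD tset_mean_cst tset_meanZ.
apply: (@le_trans _ _ (e / 2 + (2 * e)^-1 * e ^+ 2)).
  by rewrite lerD2l ler_wpM2l // invr_ge0 mulr_ge0 // ltW.
have -> : e / 2 + (2 * e)^-1 * e ^+ 2 = e by field; rewrite gt_eqF.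
by [].
Unshelve. all: by end_near.
Qed.

End EmpiricalLimit.

(** * Gauge invariance under flipping whole patterns *)

Section Gauge.
Context {R : realType}.
Variables (N M : nat) (be la h : R).

(** On booleans, equality with [e] is multiplication by the sign [spin e]: [flip true] is the
    identity and [flip false] reverses every spin. *)
Definition flip (e : bool) (s : config N) : config N := [ffun i => s i == e].

Lemma spin_flip e s i : spin R (flip e s i) = spin R (s i) * spin R e.
Proof. by rewrite ffunE; case: e; case: (s i); rewrite /spin /=; lra. Qed.

Lemma flipK e : involutive (flip e).
Proof. by move=> s; apply/ffunP => i; rewrite !ffunE; case: e; case: (s i). Qed.

Lemma cw_exponent_flip e s : cw_exponent be (h * spin R e) s = cw_exponent be h (flip e s).
Proof.
rewrite /cw_exponent; congr (_ * _ + _).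
  apply: eq_bigr => i _; apply: eq_bigr => j _.
  by rewrite !spin_flip mulrACA spin_sq mulr1.
rewrite -mulrA mulr_sumr; congr (_ * _); apply: eq_bigr => i _.
by rewrite spin_flip mulrC.
Qed.

Lemma cw_z_flip e : cw_z N be (h * spin R e) = cw_z N be h.
Proof.
rewrite /cw_z [RHS](reindex_inj (can_inj (flipK e))).
by apply: eq_bigr => s _; rewrite cw_exponent_flip.
Qed.

Variable eps : 'I_M -> bool.

Definition gauge (S : tset N M) : tset N M := [ffun mu => flip (eps mu) (S mu)].

Lemma gaugeK : involutive gauge.
Proof. by move=> S; apply/ffunP => mu; rewrite !ffunE flipK. Qed.

Lemma P_CW_gauge S : P_CW be (fun mu => h * spin R (eps mu)) S = P_CW be (fun=> h) (gauge S).
Proof.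
by apply: eq_bigr => mu _; rewrite cw_exponent_flip cw_z_flip ffunE.
Qed.

(** Each pattern enters the energy quadratically, so its sign squares to 1. *)
Lemma Zpart_gauge S : Zpart be la (gauge S) = Zpart be la S.
Proof.
apply: eq_bigr => xi _; congr expR; congr (_ + _); congr (_ * _).
apply: eq_bigr => mu _; apply: eq_bigr => i _; apply: eq_bigr => j _.
by rewrite ffunE !spin_flip (mulrACA (spin R (S mu i))) spin_sq mulr1.
Qed.

Lemma avg_free_energy_gauge :
  avg_free_energy N be la (fun mu => h * spin R (eps mu))
  = N%:R^-1 * tset_mean be h (fun S : tset N M => ln (Zpart be la S)).
Proof.
congr (_ * _); rewrite /tset_mean [RHS](reindex_inj (can_inj gaugeK)).
by apply: eq_bigr => S _; rewrite P_CW_gauge Zpart_gauge.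
Qed.

End Gauge.

(** * Bounds on [ln Zpart / N] by [gfun] and the deviation of the empirical law *)

Section FreeEnergyBounds.
Context {R : realType}.
Variables (M : nat) (be la h : R).
Hypothesis be0 : 0 < be.
Implicit Types (t : {ffun 'I_M -> bool}) (p : 'I_M -> R).

(** The product defining [empirical] is an indicator: it is 1 at the actual column of site [i], and
    any other [t] differs from that column at some [mu], where the factor is 0. *)
Lemma sum_empirical N (S : tset N M) (F : {ffun 'I_M -> bool} -> R) :
  \sum_t empirical S t * F t = N%:R^-1 * \sum_(i < N) F [ffun mu => S mu i].
Proof.
under eq_bigr do rewrite -mulrA mulr_suml.
rewrite -mulr_sumr exchange_big/=; congr (_ * _); apply: eq_bigr => i _.
rewrite (bigD1 [ffun mu => S mu i])//= big1 => [|mu _]; last first.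
  by rewrite ffunE spin_sq; field.
rewrite big1 ?mul1r ?addr0 // => t tS.
have [mu] : exists mu, t mu != S mu i.
  apply/existsP; rewrite -negb_forall; apply: contra tS => /forallP tS.
  by apply/eqP/ffunP => mu; rewrite ffunE; exact/eqP.
move=> tmu; rewrite (bigD1 mu)//= spinM eq_sym (negbTE tmu).
by rewrite mulr0 sub0r subrr !mul0r.
Qed.

Definition local_field p t : R := be * (\sum_(mu < M) spin R (t mu) * p mu) + la.

Lemma gfunE p : gfun be la h p = ln 2 - be * (\sum_(mu < M) p mu ^+ 2) / 2
  + \sum_t column_law be h t * ln (cosh (local_field p t)).
Proof. by []. Qed.

Lemma Gfun_empirical N (S : tset N M) p :
  Gfun be la S p = ln 2 - be * (\sum_(mu < M) p mu ^+ 2) / 2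
  + \sum_t empirical S t * ln (cosh (local_field p t)).
Proof.
rewrite sum_empirical; congr (_ + _ * _); apply: eq_bigr => i _.
congr (ln (cosh _)); congr (_ + _); congr (_ * _); apply: eq_bigr => mu _.
by rewrite ffunE.
Qed.

(** For [N > 0], twice the total variation distance between the two laws; all the randomness of the
    patterns enters the bounds through it. *)
Definition discrepancy N (S : tset N M) : R :=
  \sum_t `|empirical S t - column_law be h t|.

Lemma ln_cosh_field_le p t :
  ln (cosh (local_field p t)) <= be * (\sum_(mu < M) `|p mu|) + `|la|.
Proof.
apply: (le_trans (ln_cosh_le_norm _)); apply: (le_trans (ler_normD _ _)).
rewrite lerD2r normrM (gtr0_norm be0) ler_pM2l //.
apply: (le_trans (ler_norm_sum _ _ _)); apply: ler_sum => mu _.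
by rewrite normrM norm_spin mul1r.
Qed.

Lemma Gfun_gfun_dist N (S : tset N M) p :
  `|Gfun be la S p - gfun be la h p|
  <= (be * (\sum_(mu < M) `|p mu|) + `|la|) * discrepancy S.
Proof.
rewrite gfunE Gfun_empirical opprD addrACA subrr add0r -sumrB.
rewrite (le_trans (ler_norm_sum _ _ _)) // mulr_sumr; apply: ler_sum => t _.
rewrite -mulrBl normrM mulrC ler_wpM2r // ger0_norm ?ln_cosh_ge0 //.
exact: ln_cosh_field_le.
Qed.

Lemma column_law_ge0 t : 0 <= column_law be h t.
Proof.
apply: prodr_ge0 => mu _; rewrite divr_ge0 // -lerBlDl sub0r lerNl.
apply: (le_trans (ler_norm _)).
by rewrite normrN normrM norm_spin mulr1 norm_m0_le1.
Qed.

Lemma sum_column_law : \sum_(t : {ffun 'I_M -> bool}) column_law be h t = 1.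
Proof.
rewrite /column_law -(bigA_distr_bigA (fun _ b => (1 + m0 be h * spin R b) / 2)).
by rewrite big1 // => mu _; rewrite big_bool /spin /= mulr1 mulrN1; field.
Qed.

Lemma gfun_le p : gfun be la h p <= ln 2 + be * M%:R / 2 + `|la|.
Proof.
have : \sum_t column_law be h t * ln (cosh (local_field p t))
    <= be * (\sum_(mu < M) `|p mu|) + `|la|.
  rewrite -[leRHS]mul1r -{1}sum_column_law mulr_suml; apply: ler_sum => t _.
  by rewrite ler_wpM2l ?column_law_ge0 ?ln_cosh_field_le.
(* This square gives [|p mu| - p mu ^ 2 / 2 <= 1 / 2], so the quadratic term absorbs the linear
   growth of [ln (cosh x)]. *)
have : 0 <= be / 2 * \sum_(mu < M) (1 - `|p mu|) ^+ 2.
  by rewrite mulr_ge0 ?divr_ge0 ?(ltW be0) // sumr_ge0 // => mu _; exact: sqr_ge0.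
have -> : \sum_(mu < M) (1 - `|p mu|) ^+ 2
  = M%:R - 2 * (\sum_(mu < M) `|p mu|) + \sum_(mu < M) p mu ^+ 2.
  have -> : M%:R = \sum_(mu < M) 1 :> R by rewrite sumr_const card_ord.
  rewrite mulr_sumr -sumrB -big_split/=; apply: eq_bigr => mu _.
  have -> : p mu ^+ 2 = `|p mu| ^+ 2 by rewrite real_normK ?num_real.
  ring.
rewrite gfunE; lra.
Qed.

Lemma has_sup_gfun : has_sup (range (@gfun R M be la h)).
Proof.
split; first by exists (gfun be la h (fun _ : 'I_M => 0)), (fun=> 0).
by exists (ln 2 + be * M%:R / 2 + `|la|) => _ [p _ <-]; exact: gfun_le.
Qed.

Lemma Zpart_gt0 N (S : tset N M) : 0 < Zpart be la S.
Proof.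
rewrite /Zpart (bigD1 [ffun _ => true]) //=.
by rewrite ltr_pwDl ?expR_gt0 // sumr_ge0 // => xi _; exact: expR_ge0.
Qed.

(** [Gfun] is needed only at overlaps, whose entries lie in [[-1, 1]]; this makes the coefficient of
    the discrepancy uniform in [S] and [N]. The factor [(N + 1) ^ M] yields the logarithmic term. *)
Lemma ln_Zpart_le N (S : tset N M) : (0 < N)%N ->
  N%:R^-1 * ln (Zpart be la S) <= M%:R * (N%:R^-1 * ln (N.+1%:R))
    + sup (range (@gfun R M be la h)) + (be * M%:R + `|la|) * discrepancy S.
Proof.
move=> N0; set g := sup _; set D := _ * discrepancy S.
have NR0 : 0 < N%:R :> R by rewrite ltr0n.
have GB xi : Gfun be la S (overlap S xi) <= g + D.
  have := Gfun_gfun_dist S (overlap S xi).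
  move=> /(le_trans (ler_norm _)); rewrite lerBlDl => /le_trans; apply.
  apply: lerD; first by apply: sup_upper_bound; [exact: has_sup_gfun|exists (overlap S xi)].
  rewrite ler_wpM2r ?sumr_ge0 // lerD2r ler_pM2l //.
  have -> : M%:R = \sum_(mu < M) 1 :> R by rewrite sumr_const card_ord.
  by apply: ler_sum => mu _; exact: norm_overlap_le1.
have A0 : 0 < (N.+1 ^ M)%:R :> R by rewrite ltr0n expn_gt0.
have H : ln (Zpart be la S) <= M%:R * ln N.+1%:R + (N%:R * (g + D) - be * M%:R / 2).
  rewrite mulr_natl -lnXn ?ltr0n // -natrX -[X in _ + X]expRK -lnM ?posrE ?expR_gt0 //.
  rewrite ler_ln ?posrE ?Zpart_gt0 ?(mulr_gt0 A0) ?expR_gt0 //.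
  exact: (@sum_expR_energy_le R N M be la N0 S predT).
rewrite mulrC ler_pdivrMr //.
have -> : (M%:R * (N%:R^-1 * ln N.+1%:R) + g + D) * N%:R
  = M%:R * ln N.+1%:R + N%:R * (g + D) by field; rewrite gt_eqF.
rewrite (le_trans H) // lerD2l gerBl.
by rewrite divr_ge0 // mulr_ge0 // ltW.
Qed.

(** One linearization suffices here, at a point [p] independent of [S]; the coefficient of the
    discrepancy may depend on [p]. *)
Lemma ln_Zpart_ge N (S : tset N M) p : (0 < N)%N ->
  gfun be la h p - (be * (\sum_(mu < M) `|p mu|) + `|la|) * discrepancy S
    - be * M%:R / 2 * N%:R^-1
  <= N%:R^-1 * ln (Zpart be la S).
Proof.
move=> N0; have NR0 : 0 < N%:R :> R by rewrite ltr0n.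
have := @Zpart_ge R N M be la N0 be0 S p.
rewrite -ler_ln ?posrE ?Zpart_gt0 ?expR_gt0 // expRK => H.
have := Gfun_gfun_dist S p; rewrite distrC => /(le_trans (ler_norm _)) H2.
rewrite [leRHS]mulrC ler_pdivlMr // (le_trans _ H) //.
rewrite mulrBl divfK ?gt_eqF // lerB // mulrC ler_pM2l //.
by rewrite lerBlDl -lerBlDr.
Qed.

End FreeEnergyBounds.

(** * Passage to the limit *)

Lemma cvg_ln_succ_div (R : realType) :
  (fun N : nat => N%:R^-1 * ln N.+1%:R) @ \oo --> (0 : R).
Proof.
apply/cvgrPdist_le => e e0; near=> N.
have N0 : (0 < N)%N by near: N; exact: nbhs_infty_gt.
have NR0 : 0 < N%:R :> R by rewrite ltr0n.
(* Beyond this threshold [1 + (e N) ^ 2 / 2 >= N + 1], hence [exp (e N) >= N + 1]. *)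
have Ne : 2 / e ^+ 2 <= N%:R by near: N; exact: nbhs_infty_ger.
rewrite sub0r normrN ger0_norm; last first.
  by rewrite mulr_ge0 ?invr_ge0 ?ler0n // ln_ge0 // ler1n.
rewrite mulrC ler_pdivrMr // -[leRHS]expRK ler_ln ?posrE ?ltr0n ?expR_gt0 //.
have := @expR_ge1Dxn R (e * N%:R) 1 ltac:(rewrite mulr_ge0 // ltW//).
apply: le_trans; rewrite (_ : 2`! = 2%N) // -natr1 addrC lerD2l.
rewrite ler_pdivrMr ?exprn_gt0 // in Ne.
by rewrite ler_pdivlMr // exprMn; nra.
Unshelve. all: by end_near.
Qed.

Lemma discrepancy_cvg (R : realType) (M : nat) (be h : R) :
  0 < be -> be <= 1 \/ h != 0 ->
  (fun N => tset_mean be h (fun S : tset N M => discrepancy be h S)) @ \oo --> (0 : R).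
Proof.
move=> be0 uniq.
have -> : (fun N => tset_mean be h (fun S : tset N M => discrepancy be h S))
  = (fun N => \sum_(t : {ffun 'I_M -> bool})
       tset_mean be h (fun S : tset N M => `|empirical S t - column_law be h t|)).
  by apply/funext => N; rewrite -tset_mean_sum.
have z : \sum_(t : {ffun 'I_M -> bool}) 0 = 0 :> R by rewrite big1.
rewrite -[X in _ --> X]z.
by apply: cvg_big => [|t _]; [exact: add_continuous|exact: empirical_cvg].
Qed.

Theorem theorem1 (R : realType) (M : nat) (beta lambda h : R) :
  (1 <= M)%N -> 0 < beta ->
  (beta <= 1 \/ (1 < beta /\ lambda != 0 /\ h != 0)) ->
  forall eps : 'I_M -> bool,
    (fun N : nat => avg_free_energy N beta lambda (fun mu => h * spin R (eps mu)))
      @ \oo --> (sup (range (@gfun R M beta lambda h)) : R).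
Proof.
move=> _ be0 hyp eps; set g := sup _.
have uniq : beta <= 1 \/ h != 0 by case: hyp => [|[_ []]]; [left|right].
have D := @discrepancy_cvg R M beta h be0 uniq.
apply/cvgrPdist_le => e e0.
(* The lower bound has an error depending on [p], so a point [p] within [e / 2] of the supremum is
   fixed before [N] grows. *)
have [_ [p _ <-] gp] := @sup_adherent R _ (e / 2) ltac:(lra) (@has_sup_gfun R M beta lambda h be0).
(* The averaged upper bound tends to [g]; its coefficients do not depend on [p]. *)
have /cvgrPdist_le /(_ e e0) U : (fun N : nat => M%:R * (N%:R^-1 * ln (N.+1%:R)) + g
    + (beta * M%:R + `|lambda|) * tset_mean beta h (fun S : tset N M => discrepancy beta h S))
    @ \oo --> (M%:R * 0 + g + (beta * M%:R + `|lambda|) * 0 : R).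
  apply: cvgD; last by apply: cvgM; [exact: cvg_cst|exact: D].
  by apply: cvgD; [apply: cvgM; [exact: cvg_cst|exact: cvg_ln_succ_div]|exact: cvg_cst].
set C := beta * (\sum_(mu < M) `|p mu|) + `|lambda|.
(* The averaged lower bound tends to [gfun] at the fixed [p], which leaves the other [e / 2] for the
   error in [N]. *)
have /cvgrPdist_le /(_ (e / 2)) L : (fun N : nat => gfun beta lambda h p
    - C * tset_mean beta h (fun S : tset N M => discrepancy beta h S)
    - beta * M%:R / 2 * N%:R^-1)
    @ \oo --> (gfun beta lambda h p - C * 0 - beta * M%:R / 2 * 0 : R).
  apply: cvgB; last by apply: cvgM; [exact: cvg_cst|exact: cvg_invn].
  by apply: cvgB; [exact: cvg_cst|apply: cvgM; [exact: cvg_cst|exact: D]].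
move: U L; rewrite !mulr0 !subr0 add0r addr0 => U /(_ ltac:(lra)) L.
near=> N.
have N0 : (0 < N)%N by near: N; exact: nbhs_infty_gt.
(* The signs [eps] disappear here; it remains to average the bounds that hold for each [S]. *)
rewrite avg_free_energy_gauge -tset_meanZ.
rewrite distrC ler_distl; apply/andP; split.
- have : `|gfun beta lambda h p - (gfun beta lambda h p
    - C * tset_mean beta h (fun S : tset N M => discrepancy beta h S)
    - beta * M%:R / 2 * N%:R^-1)| <= e / 2 by near: N.
  move=> /(le_trans (ler_norm _)) LN.
  apply: (@le_trans _ _ (tset_mean beta h (fun S : tset N M =>
    (gfun beta lambda h p - beta * M%:R / 2 * N%:R^-1) + - C * discrepancy beta h S))).
    by rewrite tset_mean_affine mulNr -/g; move: gp; rewrite -/g; lra.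
  apply: tset_mean_le => S.
  by rewrite mulNr addrAC; exact: ln_Zpart_ge.
- have : `|g - (M%:R * (N%:R^-1 * ln (N.+1%:R)) + g
    + (beta * M%:R + `|lambda|) * tset_mean beta h (fun S : tset N M => discrepancy beta h S))|
    <= e by near: N.
  rewrite distrC => /(le_trans (ler_norm _)) UN.
  apply: (@le_trans _ _ (tset_mean beta h (fun S : tset N M =>
    M%:R * (N%:R^-1 * ln (N.+1%:R)) + g + (beta * M%:R + `|lambda|) * discrepancy beta h S))).
    by apply: tset_mean_le => S; exact: ln_Zpart_le.
  by rewrite tset_mean_affine; lra.
Unshelve. all: by end_near.
Qed.
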